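(* Let $n$ and $t$ be integers with $1\leq t\leq \frac{n-1}{2}$, let $k$ be a positive integer, and let $G=G(n;\{1,2,\ldots,t\})$ be the circulant graph on vertex set $\mathbb{Z}_n$ in which distinct vertices $i,j$ are adjacent if and only if $\min\{|i-j|,\,n-|i-j|\}\in\{1,2,\ldots,t\}$ (equivalently, $G=C_n^t$, the $t$-th power of the cycle $C_n$). Then the integer $\{k\}$-domination number of $G$ satisfies $$\gamma_k(G)=\left\lceil \frac{kn}{2t+1}\right\rceil.$$
   Context: For a simple graph $G$, a function $f:V(G)\to\mathbb{N}\cup\{0\}$ is an integer $\{k\}$-domination function if $\sum_{u\in N_G[v]}f(u)\geq k$ for every $v\in V(G)$, where $N_G[v]$ is the closed neighborhood of $v$. The integer $\{k\}$-domination number $\gamma_k(G)$ is the minimum of $\sum_{v\in V(G)}f(v)$ over all integer $\{k\}$-domination functions $f$ of $G$. *)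

(* Defs.v *)
From mathcomp Require Import all_boot all_order all_algebra.
From mathcomp Require Import boolp.

Set Implicit Arguments.
Unset Strict Implicit.
Unset Printing Implicit Defensive.

Record sgraph := SGraph {
  vertex :> finType;
  adj : rel vertex;
  adj_sym : symmetric adj;
  adj_irrefl : irreflexive adj }.

Definition closed_nbhd (G : sgraph) (v : G) : {set G} :=
  [set u | (u == v) || adj v u].

Definition dom_function (G : sgraph) (k : nat) (f : G -> nat) : Prop :=
  forall v : G, k <= \sum_(u in closed_nbhd v) f u.

Definition weight (G : sgraph) (f : G -> nat) : nat := \sum_(v : G) f v.

Definition dom_weight (G : sgraph) (k : nat) : pred nat :=
  fun m => `[< exists f : G -> nat, dom_function k f /\ weight f = m >].

Lemma dom_weight_ex (G : sgraph) (k : nat) : exists m, dom_weight G k m.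
Proof.
exists (weight (fun _ : G => k)); apply/asboolP.
exists (fun=> k); split=> // v.
by rewrite (bigD1 v) /= ?inE ?eqxx // leq_addr.
Qed.

Definition dom_number (k : nat) (G : sgraph) : nat :=
  ex_minn (dom_weight_ex G k).

Definition cyc_dist (n : nat) (i j : 'I_n) : nat :=
  let d := absz ((i : nat)%:Z - (j : nat)%:Z)%R in minn d (n - d).

Definition circ_adj (n : nat) (S : pred nat) : rel 'I_n :=
  fun i j => (i != j) && S (cyc_dist i j).

Lemma circ_adj_sym (n : nat) (S : pred nat) : symmetric (@circ_adj n S).
Proof. by move=> i j; rewrite /circ_adj /cyc_dist eq_sym distnC. Qed.

Lemma circ_adj_irrefl (n : nat) (S : pred nat) : irreflexive (@circ_adj n S).
Proof. by move=> i; rewrite /circ_adj eqxx. Qed.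

(* The circulant graph G(n; S), with Z_n represented by the residues 0..n-1. *)
Definition circulant (n : nat) (S : pred nat) : sgraph :=
  SGraph (@circ_adj_sym n S) (@circ_adj_irrefl n S).

(* Main.v *)
Require Import Defs.
From mathcomp Require Import all_boot all_order all_algebra.
From mathcomp Require Import boolp zify.

(** Write [m = 2 t + 1]. Every closed neighbourhood of [C_n^t] is a cyclic arc
    of [m] consecutive vertices. Double counting pairs (vertex, neighbour) gives
    [k n <= m w] for the weight [w] of any {k}-dominating function. Conversely,
    if [k n <= m w], spread the weight [w] evenly: the increments of
    [x |-> floor (x w / n)] are [n]-periodic, so even along an arc that wraps
    around they telescope, and their sum over any [m] consecutive vertices is at
    least [floor (m w / n) >= k]. *)

Set Implicit Arguments.
Unset Strict Implicit.
Unset Printing Implicit Defensive.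

Import Order.TTheory GRing.Theory Num.Theory.

Section RatioCeiling.

Local Open Scope ring_scope.

Lemma eq_ceil_ratio (R : archiRealFieldType) (a m d : nat) :
    (0 < m)%N -> (forall w : nat, (d <= w)%N = (a <= m * w)%N) ->
  d%:Z = Num.ceil (a%:R / m%:R : R).
Proof.
move=> m_gt0 d_min; set c := Num.ceil _.
have c_le (w : nat) : (c <= w%:Z) = (d <= w)%N.
  by rewrite d_min ceil_le_int ler_pdivrMr ?ltr0n // mulrC -natrM ler_nat.
have c_ge0 : 0 <= c by rewrite ceil_ge0 (lt_le_trans (ltrN10 _)) // divr_ge0.
apply/le_anti; rewrite c_le leqnn andbT.
by rewrite -(gez0_abs c_ge0) lez_nat -c_le gez0_abs.
Qed.

End RatioCeiling.

Section DominationNumber.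

Variable G : sgraph.
Implicit Types (u v : G) (f : G -> nat).

Lemma closed_nbhdC u v : (u \in closed_nbhd v) = (v \in closed_nbhd u).
Proof. by rewrite !inE eq_sym adj_sym. Qed.

Lemma sum_closed_nbhd f :
  \sum_v \sum_(u in closed_nbhd v) f u = \sum_u #|closed_nbhd u| * f u.
Proof.
rewrite (exchange_big_dep predT) //=; apply: eq_bigr => u _.
by rewrite -sum_nat_const; apply: eq_bigl => v; apply: closed_nbhdC.
Qed.

Lemma dom_function_leq_weight m k f :
    (forall v, #|closed_nbhd v| <= m) -> dom_function k f ->
  k * #|G| <= m * weight f.
Proof.
move=> card_le_m dom_f; rewrite mulnC -sum_nat_const.
apply: leq_trans (_ : _ <= \sum_v \sum_(u in closed_nbhd v) f u) _.
  by apply: leq_sum => v _; apply: dom_f.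
rewrite sum_closed_nbhd /weight big_distrr /=.
by apply: leq_sum => u _; rewrite leq_mul2r card_le_m orbT.
Qed.

Lemma dom_number_leq_weight k f :
  dom_function k f -> dom_number k G <= weight f.
Proof.
rewrite /dom_number; case: ex_minnP => d _ min_d dom_f.
by apply: min_d; apply/asboolP; exists f.
Qed.

Lemma dom_number_attained k :
  exists2 f : G -> nat, dom_function k f & weight f = dom_number k G.
Proof.
by rewrite /dom_number; case: ex_minnP => d /asboolP[f [? ?]] _; exists f.
Qed.

Lemma leq_dom_number m k :
  (forall v, #|closed_nbhd v| <= m) -> k * #|G| <= m * dom_number k G.
Proof.
move=> card_le_m; have [f dom_f <-] := dom_number_attained k.
exact: dom_function_leq_weight.
Qed.

End DominationNumber.

Section CyclicArc.

Variable n : nat.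
Implicit Types a u v : 'I_n.+1.

Definition arc a (m : nat) : {set 'I_n.+1} := [set u | (u - a)%R < m].

Lemma big_arc (R : Type) (idx : R) (op : Monoid.com_law idx) (F : 'I_n.+1 -> R)
    a m :
  m <= n.+1 ->
  \big[op/idx]_(u in arc a m) F u = \big[op/idx]_(j < m) F (a + inZp j)%R.
Proof.
move=> le_mn.
rewrite (big_ord_widen _ (fun j => F (a + inZp j)%R) le_mn).
rewrite (reindex_inj (addrI a)).
by apply: eq_big => j; rewrite ?inE ?valZpK // [(a + j)%R]addrC addrK.
Qed.

Lemma card_arc a m : m <= n.+1 -> #|arc a m| = m.
Proof. by move=> le_mn; rewrite -sum1_card big_arc // sum1_card card_ord. Qed.

Lemma val_subZp u v :
  (u - v)%R = (if v <= u then u - v else u + n.+1 - v) :> nat.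
Proof.
have lt_un := ltn_ord u; have lt_vn := ltn_ord v; rewrite /= modnDmr.
case: (leqP v u) => [le_vu | lt_uv]; last by rewrite modn_small; lia.
by rewrite addnBCA ?modnDl ?modn_small; lia.
Qed.

Lemma cyc_distE u v : cyc_dist u v = minn (v - u)%R (n.+1 - (v - u)%R).
Proof.
have lt_un := ltn_ord u; have lt_vn := ltn_ord v.
by rewrite val_subZp /cyc_dist; case: (leqP u v); lia.
Qed.

Lemma cyc_dist_eq0 u v : (cyc_dist u v == 0) = (u == v).
Proof.
rewrite cyc_distE [RHS]eq_sym -subr_eq0; move: (v - u)%R => d.
by have lt_dn := ltn_ord d; rewrite -[RHS](inj_eq val_inj) /=; lia.
Qed.

Lemma cyc_dist_leqE t u v :
  2 * t + 1 <= n.+1 ->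
  (cyc_dist u v <= t) = (v \in arc (u - inZp t)%R (2 * t + 1)).
Proof.
move=> le_tn; rewrite cyc_distE inE opprB addrCA.
move: (v - u)%R => d; have lt_dn := ltn_ord d; rewrite /= modnDml.
case: (ltnP (t + d) n.+1) => [lt_tdn | le_ntd].
  by rewrite modn_small //; lia.
by rewrite -(subnK le_ntd) modnDr modn_small; lia.
Qed.

End CyclicArc.

Section BalancedWord.

Variables w n : nat.
Hypothesis n_gt0 : 0 < n.

Definition balanced_word (x : nat) : nat := (x.+1 * w) %/ n - (x * w) %/ n.

Lemma balanced_word_mod x : balanced_word (x %% n) = balanced_word x.
Proof.
rewrite /balanced_word [in RHS](divn_eq x n) -addnS.
by rewrite !mulnDl mulnAC !divnMDl // subnDl.
Qed.

Lemma sum_balanced_word a m :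
  \sum_(j < m) balanced_word (a + j) = ((a + m) * w) %/ n - (a * w) %/ n.
Proof.
pose F j := ((a + j) * w) %/ n.
have F_mono : {homo F : i j / i <= j}.
  by move=> i j le_ij; rewrite leq_div2r // leq_mul2r leq_add2l le_ij orbT.
rewrite -[a in X in _ - X]addn0 -(telescope_sumn 0 m F_mono) big_mkord.
by apply: eq_bigr => j _; rewrite /F addnS.
Qed.

Lemma leq_sum_balanced_word a m :
  (m * w) %/ n <= \sum_(j < m) balanced_word (a + j).
Proof. by rewrite sum_balanced_word mulnDl divnD //; lia. Qed.

Lemma balanced_word_total : \sum_(j < n) balanced_word j = w.
Proof. by rewrite (sum_balanced_word 0) add0n mul0n div0n subn0 mulKn. Qed.

End BalancedWord.

Definition cycle_power (n t : nat) : sgraph :=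
  circulant n (fun d => 1 <= d <= t).

Section CyclePower.

Variables n t : nat.
Hypothesis le_tn : 2 * t + 1 <= n.+1.
Let G := cycle_power n.+1 t.

Lemma closed_nbhd_cycle_power (v : G) :
  closed_nbhd v = arc (v - inZp t : 'I_n.+1)%R (2 * t + 1).
Proof.
apply/setP => u; rewrite -cyc_dist_leqE // inE eq_sym /= /circ_adj.
by rewrite -(cyc_dist_eq0 v u) -lt0n; case: (cyc_dist v u).
Qed.

Lemma card_closed_nbhd_cycle_power (v : G) : #|closed_nbhd v| = 2 * t + 1.
Proof. by rewrite closed_nbhd_cycle_power card_arc. Qed.

Lemma dom_function_balanced_word k w :
    k * n.+1 <= (2 * t + 1) * w ->
  dom_function k (fun v : G => balanced_word w n.+1 (v : 'I_n.+1)).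
Proof.
move=> le_kw v; rewrite closed_nbhd_cycle_power big_arc //=.
under eq_bigr => j _ do rewrite /= modnDmr balanced_word_mod //.
by apply: leq_trans (leq_sum_balanced_word _ _ _ _); rewrite ?leq_divRL.
Qed.

Lemma dom_number_cycle_power_leq k w :
  (dom_number k G <= w) = (k * n.+1 <= (2 * t + 1) * w).
Proof.
apply/idP/idP => [le_dw | le_kw].
  apply: leq_trans (_ : (2 * t + 1) * dom_number k G <= _).
    rewrite -[n.+1]card_ord; apply: leq_dom_number => v.
    by rewrite card_closed_nbhd_cycle_power.
  by rewrite leq_mul2l le_dw orbT.
rewrite -[leqRHS](balanced_word_total w (ltn0Sn n)).
exact/dom_number_leq_weight/dom_function_balanced_word.
Qed.

End CyclePower.

Local Open Scope ring_scope.

Theorem theorem2p8 (n t k : nat) (t_ge1 : (1 <= t)%N)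
  (t_le : t%:R <= (n%:R - 1) / 2 :> rat) (k_gt0 : (0 < k)%N) :
  (dom_number k (circulant n (fun d => (1 <= d <= t)%N)))%:Z =
    Num.ceil ((k * n)%:R / (2 * t + 1)%:R : rat).
Proof.
have le_tn : (2 * t + 1 <= n)%N.
  by move: t_le; rewrite ler_pdivlMr // lerBrDr -natrM natr1 ler_nat; lia.
case: n le_tn {t_le} => [|n] le_tn; first by rewrite addn1 in le_tn.
apply: eq_ceil_ratio => [|w]; first by rewrite addn1.
exact: dom_number_cycle_power_leq.
Qed.
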